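(* Let $p,q\in\mathbb{Z}_+$, $\mathbf{h}'\in\mathbb{R}_+^{p+1}$, $\mathbf{h}''\in\mathbb{R}_+^{q+1}$. Let $C_0,\ldots,C_p$ and $D_0,\ldots,D_q$ be two families of closed linear operators from $H$ to $H'$ (with domains in $H$) such that each of the two families $(T_j)=(C_j)_{j=0}^p$ and $(T_j)=(D_j)_{j=0}^q$ satisfies: every $e_n$, $n\in M$, lies in the domain of every $T_j$; $(T_je_{n'},T_je_{n''})_{H'}=0$ for every $j$ and all $n'\neq n''$ in $M$; and $T_{j_0}e_{n_0}\neq0$ for some $j_0$ and some $n_0\in M$. Let $X$ be a normed space over $\mathbb{C}$, $A:H\to X$ a linear operator with domain $\mathcal{D}(A)\subset H$, and $f\in X^*$ a bounded linear functional such that: $e_n\in\mathcal{D}(A)$ for every $n\in M$; $\langle f,Ae_{n_0}\rangle\neq0$ for some $n_0\in M$; and the functional $g_f(x)=\langle f,Ax\rangle$ from $H$ to $\mathbb{C}$ with domain $\mathcal{D}(A)$ is closable. Assume that $$\widetilde{\sum_{n\in M}}\frac{|\langle f,Ae_n\rangle|^2}{b_{n,\mathbf{1}}}<\infty .$$ Let either $N\in(N^*,+\infty)$ if $f\circ A:H_{\mathbf{C},\mathbf{h}'}\to\mathbb{C}$ is unbounded, or $N\in(N^*,\|f\circ A\|]$ if $f\circ A:H_{\mathbf{C},\mathbf{h}'}\to\mathbb{C}$ is bounded, and let $\mu\geqslant0$ be such that $N=\|G_\mu\|$. Then $$E_N\left(f\circ A;W_{\mathbf{D},\mathbf{h}''}\right)=\mu\cdot\left(\widetilde{\sum_{n\in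 M}}\frac{|\langle f,Ae_n\rangle|^2d_{n,\mathbf{h}''}}{(c_{n,\mathbf{h}'}+\mu d_{n,\mathbf{h}''})^2}\right)^{1/2},$$ and the functional $G_\mu$ is extremal, i.e. the infimum defining $E_N(f\circ A;W_{\mathbf{D},\mathbf{h}''})$ is attained at $S=G_\mu$. (For $\mu=0$ the right-hand side is understood as its limit as $\mu\to0^+$.)
   Context: $\mathbb{R}_+=(0,+\infty)$; $\mathbb{Z}_+$ is the set of non-negative integers; $\mathbf{1}=(1,\ldots,1)$. $H$ is a separable Hilbert space over $\mathbb{C}$ with orthonormal basis $\{e_n\}_{n\in M}$, $M$ finite or countable; $x_n:=(x,e_n)_H$. Sums over $M$ are limits of sums over a fixed sequence of nested finite sets $M_1\subset M_2\subset\ldots$ with union $M$. $H'$ is a Hilbert space over $\mathbb{C}$. For non-negative sequences $\{a_n\},\{b_n\}$, the sum $\widetilde{\sum}_{n\in M}\frac{a_n}{b_n}$ equals $+\infty$ if there is $n_0$ with $a_{n_0}\neq0$ and $b_{n_0}=0$, and otherwise equals $\sum_{n\in M:\,b_n\neq0}\frac{a_n}{b_n}$ (an empty sum is $0$). In $\widetilde{\sum}$ with complex terms, the terms with zero numerator and zero denominator are likewise omitted. $c_{n,\mathbf{h}'}:=\sum_{j=0}^p h_j'\|C_je_n\|_{H'}^2$, $d_{n,\mathbf{h}''}:=\sum_{j=0}^q h_j''\|D_je_n\|_{H'}^2$, and $b_{n,\mathbf{1}}:=\sum_{j=0}^p\|C_je_n\|_{H'}^2+\sum_{j=0}^q\|D_je_n\|_{H'}^2$.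 $H_{\mathbf{C}}:=\{x\in H:\sum_{n}|x_n|^2\|C_je_n\|_{H'}^2<\infty,\ j=0,\ldots,p\}$ with seminorm $\|x\|_{\mathbf{C},\mathbf{h}'}:=(\sum_n|x_n|^2c_{n,\mathbf{h}'})^{1/2}$; with this seminorm it is denoted $H_{\mathbf{C},\mathbf{h}'}$. $H_{\mathbf{D}}$ and $\|x\|_{\mathbf{D},\mathbf{h}''}:=(\sum_n|x_n|^2d_{n,\mathbf{h}''})^{1/2}$ are defined in the same way from the $D_j$. The class is $$W_{\mathbf{D},\mathbf{h}''}:=\{x\in\mathcal{D}(A)\cap H_{\mathbf{C}}\cap H_{\mathbf{D}}:\ \|x\|_{\mathbf{D},\mathbf{h}''}\leqslant1\}.$$ The functional $f\circ A$ is $x\mapsto\langle f,Ax\rangle$ on $\mathcal{D}(A)\cap H_{\mathbf{C}}$; its boundedness and its norm $\|f\circ A\|$ are with respect to the seminorm $\|\cdot\|_{\mathbf{C},\mathbf{h}'}$. For $\mu\geqslant0$, $$G_\mu x:=\widetilde{\sum_{n\in M}}\frac{\langle f,Ae_n\rangle\,c_{n,\mathbf{h}'}}{c_{n,\mathbf{h}'}+\mu d_{n,\mathbf{h}''}}\,x_n,\qquad x\in H_{\mathbf{C},\mathbf{h}'},$$ and $\|G_\mu\|$ is its norm as a functional on $H_{\mathbf{C},\mathbf{h}'}$ ($+\infty$ if unbounded). Finally $N^*:=\lim_{\mu\to+\infty}\|G_\mu\|=\left(\sum_{n\in M^*}\frac{|\langle f,Ae_n\rangle|^2}{c_{n,\mathbf{h}'}}\right)^{1/2}$,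 where $M^*:=\{n\in M:\ c_{n,\mathbf{h}'}\neq0,\ d_{n,\mathbf{h}''}=0\}$. Best approximation (Stechkin problem): for $N>0$, $$E_N(f\circ A;W_{\mathbf{D},\mathbf{h}''}):=\inf_{S}\ \sup_{x\in W_{\mathbf{D},\mathbf{h}''}}|\langle f,Ax\rangle-Sx|,$$ the infimum being over all linear functionals $S:H_{\mathbf{C},\mathbf{h}'}\to\mathbb{C}$ bounded with respect to $\|\cdot\|_{\mathbf{C},\mathbf{h}'}$ with norm at most $N$. An operator is closable if the closure of its graph is the graph of an operator. *)

(* Defs.v *)
(* The field of complex numbers is [R[i]] for an arbitrary [R : realType]; it is
   taken as [R[i]^o] where its topology is needed. *)
From HB Require Import structures.
From mathcomp Require Import all_boot all_order all_algebra finmap.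
From mathcomp Require Import complex sesquilinear.
From mathcomp Require Import all_classical all_reals all_analysis.

Set Implicit Arguments.
Unset Strict Implicit.
Unset Printing Implicit Defensive.

Import Order.TTheory GRing.Theory Num.Theory.
Import numFieldNormedType.Exports.

Local Open Scope classical_set_scope.
Local Open Scope ring_scope.

(* The norm of an [R[i]]-normed space is [R[i]]-valued (with zero imaginary
   part); [rnorm] is the same norm, valued in [R]. *)
Definition rnorm (R : realType) (V : normedZmodType R[i]) (v : V) : R :=
  complex.Re `|v|.

(* The inner product is linear in its first argument. *)
Record hilbertSpace (R : realType) := HilbertSpace {
  hilbert_sort :> completeNormedModType R[i];
  inner : {dot hilbert_sort for Num.conj};
  inner_norm : forall x, inner x x = `|x| ^+ 2
}.

Definition orthonormal_basis (R : realType) (H : hilbertSpace R)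
    (M : countType) (e : M -> H) : Prop :=
  (forall n m, inner H (e n) (e m) = (n == m)%:R) /\
  closure [set x : H | exists (s : seq M) (k : M -> R[i]),
                         x = \sum_(n <- s) k n *: e n] = setT.

Definition exhausting (M : countType) (Mk : nat -> {fset M}) : Prop :=
  (forall k, (Mk k `<=` Mk k.+1)%fset) /\ (forall n, exists k, n \in Mk k).

Section PartialOperators.
Context (K : pzRingType).

Definition linear_on (V W : lmodType K) (D : set V) (T : V -> W) : Prop :=
  forall (k : K) x y, D x -> D y -> T (k *: x + y) = k *: T x + T y.

(* A linear operator defined on a linear subspace [dom] of [V]; the values of
   [op_fun] outside [dom] are irrelevant. *)
Record operator (V W : lmodType K) := Operator {
  dom : set V;
  op_fun :> V -> W;
  dom0 : dom 0;
  domP : forall (k : K) x y, dom x -> dom y -> dom (k *: x + y);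
  op_linear : linear_on dom op_fun
}.

Definition op_graph (V W : lmodType K) (T : operator V W) : set (V * W) :=
  [set z | dom T z.1 /\ z.2 = T z.1].

Lemma comp_linear_on (V W Z : lmodType K) (f : {linear W -> Z})
  (T : operator V W) : linear_on (dom T) (fun x => f (T x)).
Proof. by move=> k x y Dx Dy; rewrite (op_linear k Dx Dy) linearP. Qed.

Definition comp_op (V W Z : lmodType K) (f : {linear W -> Z})
    (T : operator V W) : operator V Z :=
  Operator (dom0 T) (@domP V W T) (@comp_linear_on V W Z f T).

End PartialOperators.

Definition closed_operator (R : realType) (V W : normedModType R[i])
    (T : operator V W) : Prop :=
  closed (op_graph T : set (V * W)%type).

Definition closable (R : realType) (V W : normedModType R[i])
    (T : operator V W) : Prop :=
  exists T' : operator V W,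
    closure (op_graph T : set (V * W)%type) = op_graph T'.

Section Sums.
Context (R : realType) (M : countType) (Mk : nat -> {fset M}).
Local Open Scope ereal_scope.

(* Sum of a family of non-negative reals: its partial sums over the [Mk k] are
   nondecreasing, so the limit exists in [\bar R]. *)
Definition nnsum (P : pred M) (a : M -> R) : \bar R :=
  limn (fun k => \sum_(n <- Mk k | P n) (a n)%:E).

(* Sum of quotients with the conventions [a / 0 = +oo] for [a != 0], and
   [0 / 0] omitted. *)
Definition quotient_sum (a b : M -> R) : \bar R :=
  if `[< exists n, (a n != 0)%R /\ b n = 0%R >] then +oo
  else nnsum (fun n => b n != 0%R) (fun n => a n / b n)%R.

Definition csum (P : pred M) (z : M -> R[i]) : R[i] :=
  limn (fun k => (\sum_(n <- Mk k | P n) z n)%R : R[i]^o).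

End Sums.

Section Seminorms.
Context (R : realType) (M : countType) (Mk : nat -> {fset M}).
Context (H H' : hilbertSpace R) (e : M -> H).
Local Open Scope ereal_scope.

Definition adapted (r : nat) (T : 'I_r.+1 -> operator H H') : Prop :=
  [/\ forall j n, dom (T j) (e n),
      forall j n m, n != m -> inner H' (T j (e n)) (T j (e m)) = 0%R
    & exists j n, T j (e n) != 0%R].

(* [weight C h'] is c_{n,h'} and [weight D h''] is d_{n,h''}. *)
Definition weight (r : nat) (T : 'I_r.+1 -> operator H H') (h : 'I_r.+1 -> R)
    (n : M) : R :=
  (\sum_j h j * rnorm (T j (e n)) ^+ 2)%R.

Definition coef (x : H) (n : M) : R[i] := inner H x (e n).

(* The spaces H_C and H_D. *)
Definition wspace (r : nat) (T : 'I_r.+1 -> operator H H') : set H :=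
  [set x | forall j, nnsum Mk predT
     (fun n => rnorm (coef x n) ^+ 2 * rnorm (T j (e n)) ^+ 2)%R < +oo].

Definition wseminorm (w : M -> R) (x : H) : \bar R :=
  sqrte (nnsum Mk predT (fun n => rnorm (coef x n) ^+ 2 * w n)%R).

End Seminorms.

Section Functionals.
Context (R : realType) (V : lmodType R[i]).
Local Open Scope ereal_scope.

(* Boundedness and norm, with respect to the seminorm [s], of a functional
   defined on [D]. *)
Definition seminorm_bounded (D : set V) (s : V -> \bar R)
    (S : V -> R[i]^o) : Prop :=
  exists K : R, forall x, D x -> (rnorm (S x))%:E <= K%:E * s x.

Definition fun_norm (D : set V) (s : V -> \bar R) (S : V -> R[i]^o) : \bar R :=
  ereal_sup [set (rnorm (S x))%:E | x in [set x | D x /\ s x <= 1]].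

(* The linear functionals on [D], bounded with norm at most [N]; only the
   values of [S] on [D] matter. *)
Definition approximants (D : set V) (s : V -> \bar R) (N : R) :
    set (V -> R[i]^o) :=
  [set S | [/\ linear_on D S, seminorm_bounded D s S & fun_norm D s S <= N%:E]].

Definition deviation (W : set V) (g S : V -> R[i]^o) : \bar R :=
  ereal_sup [set (rnorm (g x - S x))%:E | x in W].

Definition best_approx (D : set V) (s : V -> \bar R) (W : set V)
    (g : V -> R[i]^o) (N : R) : \bar R :=
  ereal_inf [set deviation W g S | S in approximants D s N].

End Functionals.

Section Extremal.
Context (R : realType) (M : countType) (Mk : nat -> {fset M}).
Context (H : hilbertSpace R) (e : M -> H).
Context (a : M -> R[i]^o) (c d : M -> R).
Local Open Scope ereal_scope.

(* G_mu, with a_n standing for <f, A e_n>.  As c, d, mu >= 0, a vanishing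
   denominator forces a vanishing numerator, so the omitted terms are exactly
   those of the form 0 / 0. *)
Definition Gmu (mu : R) (x : H) : R[i]^o :=
  csum Mk (fun n => (c n + mu * d n)%R != 0%R)
    (fun n => a n * (c n)%:C%C / (c n + mu * d n)%:C%C * coef e x n)%R.

(* N^*, the limit of ||G_mu|| as mu tends to +oo. *)
Definition Nstar (HC : set H) : \bar R :=
  lim (fun_norm HC (wseminorm Mk e c) (Gmu mu) @[mu --> +oo%R]).

Definition extremal_error_pos (mu : R) : \bar R :=
  mu%:E * sqrte (quotient_sum Mk (fun n => rnorm (a n) ^+ 2 * d n)%R
                                 (fun n => (c n + mu * d n) ^+ 2)%R).

(* At mu = 0 the formula may take the form 0 * +oo; its value there is its limit
   from the right. *)
Definition extremal_error (mu : R) : \bar R :=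
  if mu == 0%R then lim (extremal_error_pos nu @[nu --> 0%R^'+])
  else extremal_error_pos mu.

End Extremal.

(* Main.v *)
(* A closable functional is bounded, so <f, A x> = sum_n a_n x_n on the domain
   of A, with a_n = <f, A e_n> square summable.  Put r_n = c_n / (c_n + mu d_n),
   N_mu^2 = sum |a_n|^2 r_n^2 / c_n and E^2 = sum |a_n|^2 (1 - r_n)^2 / d_n.  By
   the Cauchy-Schwarz inequality and truncated extremal sequences, ||G_mu|| = N_mu,
   and G_mu deviates from f o A by at most E on W.  Conversely take
   y = sum_n conj(a_n) tau_n e_n over a finite index set, where
   1 - r_n = tau_n d_n and mu r_n = tau_n c_n: with N_F and D_F the truncations
   of N_mu and E, one has <f, A y> = mu N_F^2 + D_F^2, ||y||_C = mu N_F and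
   ||y||_D = D_F, so any S of norm at most N = N_mu deviates on W by at least
   (mu N_F^2 + D_F^2 - N mu N_F) / D_F, which tends to E.  Finally E is the stated
   error: for mu > 0 this is algebra, and for mu = 0 it follows from
   E_0^2 <= E_nu^2 <= E_0^2 + nu N^2. *)
Require Import Defs.
From HB Require Import structures.
From mathcomp Require Import all_boot all_order all_algebra finmap.
From mathcomp Require Import complex sesquilinear.
From mathcomp Require Import all_classical all_reals all_analysis.
From mathcomp Require Import ring lra.
Set Implicit Arguments.
Unset Strict Implicit.
Unset Printing Implicit Defensive.
Import Order.TTheory GRing.Theory Num.Theory.
Import numFieldNormedType.Exports.
Local Open Scope classical_set_scope.
Local Open Scope ring_scope.

(** * Norms and sums over exhausting sequences of finite sets *)

Section Rnorm.
Context (R : realType) (V : normedZmodType R[i]).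
Implicit Types u v : V.

Lemma rnormE v : `|v| = (rnorm v)%:C%C.
Proof. by rewrite /rnorm RRe_real// normr_real. Qed.

Lemma rnorm_ge0 v : 0 <= rnorm v.
Proof. by rewrite -ler0c -rnormE. Qed.

Lemma rnorm0 : rnorm (0 : V) = 0.
Proof. by rewrite /rnorm normr0. Qed.

Lemma rnorm_eq0 v : (rnorm v == 0) = (v == 0).
Proof. by rewrite -[RHS]normr_eq0 rnormE -[LHS](inj_eq (@complexI R)). Qed.

Lemma rnormN v : rnorm (- v) = rnorm v.
Proof. by rewrite /rnorm normrN. Qed.

Lemma rnormB u v : rnorm (u - v) = rnorm (v - u).
Proof. by rewrite -rnormN opprB. Qed.

Lemma ler_rnormD u v : rnorm (u + v) <= rnorm u + rnorm v.
Proof. by rewrite -lecR rmorphD/= -!rnormE ler_normD. Qed.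

Lemma ler_rnorm_sum (I : Type) (s : seq I) (F : I -> V) :
  rnorm (\sum_(i <- s) F i) <= \sum_(i <- s) rnorm (F i).
Proof.
elim: s => [|i s IH]; first by rewrite !big_nil rnorm0.
by rewrite !big_cons (le_trans (ler_rnormD _ _))// lerD2l.
Qed.

End Rnorm.

Section RnormScalar.
Context (R : realType).
Implicit Types x y : R[i].

Lemma rnormM x y : rnorm (x * y : R[i]^o) = rnorm (x : R[i]^o) * rnorm (y : R[i]^o).
Proof. by apply: complexI; rewrite rmorphM/= -!rnormE normrM. Qed.

Lemma rnormC (r : R) : rnorm (r%:C%C : R[i]^o) = `|r|.
Proof. by rewrite /rnorm normc_def/= expr0n addr0 sqrtr_sqr. Qed.

Lemma rnorm_conj x : rnorm (Num.conj x : R[i]^o) = rnorm (x : R[i]^o).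
Proof. by rewrite /rnorm norm_conjC. Qed.

Lemma rnormZ (V : normedModType R[i]) x (v : V) :
  rnorm (x *: v) = rnorm (x : R[i]^o) * rnorm v.
Proof. by apply: complexI; rewrite rmorphM/= -!rnormE normrZ. Qed.

Lemma mul_conj_rnorm x : x * Num.conj x = (rnorm (x : R[i]^o) ^+ 2)%:C%C.
Proof. by rewrite rmorphXn/= -rnormE -normCK. Qed.

End RnormScalar.

Section Distance.
Context (R : realType) (V : normedModType R[i]).

(** A positive element of [R[i]] is real, so it is enough to test real radii. *)
Lemma cvgn_rnormP (u : V^nat) (l : V) :
  u @ \oo --> l <->
  forall eps : R, 0 < eps -> \forall n \near \oo, rnorm (l - u n) <= eps.
Proof.
split=> [/cvgrPdist_le ul eps eps0|ul].
  have := ul eps%:C%C; rewrite ltcR => /(_ eps0).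
  by apply: filterS => n; rewrite rnormE lecR.
apply/cvgrPdist_le => eps eps0.
have epsE : eps = (complex.Re eps)%:C%C by rewrite RRe_real// gtr0_real.
move: eps0; rewrite epsE ltcR => /ul.
by apply: filterS => n; rewrite rnormE lecR.
Qed.

Lemma closure_rnormP (A : set V) (x : V) :
  closure A x -> forall eps : R, 0 < eps -> exists2 y, A y & rnorm (x - y) <= eps.
Proof.
move=> Ax eps eps0.
have e0 : 0 < eps%:C%C by rewrite ltcR.
have [y [Ay xy]] := Ax _ (nbhsx_ballx x _ e0).
exists y => //; move: xy; rewrite -ball_normE/= rnormE ltcR; exact: ltW.
Qed.

End Distance.

Section Sums.
Context (R : realType).

(** Induction on the list. The new cross term satisfies [2 * S * a * b <= A * b ^+ 2 + B * a ^+ 2],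
    by the induction hypothesis [S ^+ 2 <= A * B] and the inequality of arithmetic and geometric
    means. *)
Lemma big_cauchy_schwarz (I : Type) (s : seq I) (x y : I -> R) :
  (\sum_(i <- s) x i * y i) ^+ 2 <=
  (\sum_(i <- s) x i ^+ 2) * (\sum_(i <- s) y i ^+ 2).
Proof.
elim: s => [|i s]; first by rewrite !big_nil mul0r expr0n.
rewrite !big_cons.
have : 0 <= \sum_(j <- s) x j ^+ 2 by apply: sumr_ge0 => j _; exact: sqr_ge0.
have : 0 <= \sum_(j <- s) y j ^+ 2 by apply: sumr_ge0 => j _; exact: sqr_ge0.
set B := \sum_(j <- s) y j ^+ 2; set A := \sum_(j <- s) x j ^+ 2.
set S := \sum_(j <- s) _; move: A B S (x i) (y i) => A B S a b B0 A0 SAB.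
suff : 2 * (S * (a * b)) <= A * b ^+ 2 + B * a ^+ 2 by nra.
have AB0 : 0 <= A * b ^+ 2 + B * a ^+ 2.
  by rewrite addr_ge0// mulr_ge0// sqr_ge0.
apply: (le_trans (ler_norm _)).
rewrite -(@ler_pXn2r _ 2) ?nnegrE// -normrX ger0_norm ?sqr_ge0//.
have : S ^+ 2 * (a * b) ^+ 2 <= A * B * (a * b) ^+ 2 by rewrite ler_wpM2r// sqr_ge0.
have := sqr_ge0 (A * b ^+ 2 - B * a ^+ 2).
nra.
Qed.

(** Cauchy-Schwarz for [u / sqrt w] and [v * sqrt w]. Where [w] vanishes so does [u], and the
    convention [0^-1 = 0] makes these indices harmless. *)
Lemma weighted_cauchy_schwarz (I : Type) (s : seq I) (u v w : I -> R) :
  (forall i, 0 <= w i) -> (forall i, w i = 0 -> u i = 0) ->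
  \sum_(i <- s) u i * v i <=
  Num.sqrt (\sum_(i <- s) u i ^+ 2 / w i) * Num.sqrt (\sum_(i <- s) v i ^+ 2 * w i).
Proof.
move=> w0 uw.
rewrite -sqrtrM; last by apply: sumr_ge0 => i _; rewrite mulr_ge0 ?invr_ge0// sqr_ge0.
apply: (le_trans (ler_norm _)); rewrite -sqrtr_sqr ler_wsqrtr//.
have := big_cauchy_schwarz s (fun i => u i / Num.sqrt (w i)) (fun i => v i * Num.sqrt (w i)).
under eq_bigr => i _ do [rewrite mulrACA [_^-1 * _]mulrC].
rewrite [X in X ^+ 2](_ : _ = \sum_(i <- s) u i * v i); last first.
  apply: eq_bigr => i _; have [wi0|wi0] := eqVneq (w i) 0; first by rewrite uw// !mul0r.
  by rewrite divff ?mulr1// sqrtr_eq0 -ltNge lt_neqAle eq_sym wi0 w0.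
under [X in _ <= X * _]eq_bigr => i _ do rewrite exprMn exprVn sqr_sqrtr//.
by under [X in _ <= _ * X]eq_bigr => i _ do rewrite exprMn sqr_sqrtr//.
Qed.

Context (M : countType) (Mk : nat -> {fset M}) (hMk : exhausting Mk).

Lemma exhausting_mono k l : (k <= l)%N -> (Mk k `<=` Mk l)%fset.
Proof.
move=> /subnKC <-; elim: (l - k)%N => [|m IH]; first by rewrite addn0.
by rewrite addnS (fsubset_trans IH)//; exact: hMk.1.
Qed.

Lemma exhausting_near n : \forall k \near \oo, n \in Mk k.
Proof.
have [k nk] := hMk.2 n; exists k => // l /= kl.
exact: (fsubsetP (exhausting_mono kl)).
Qed.

Lemma ler_sum_exhausting (a : M -> R) k l : (forall n, 0 <= a n) -> (k <= l)%N ->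
  \sum_(n <- Mk k) a n <= \sum_(n <- Mk l) a n.
Proof.
move=> a0 kl; rewrite [leRHS](big_fsetID _ (mem (Mk k)))/=.
rewrite [X in _ <= X + _](_ : _ = \sum_(n <- Mk k) a n).
  by rewrite lerDl sumr_ge0.
congr bigop; congr enum_fset; apply/fsetP => n; rewrite !inE andbC/=.
by case: (boolP (n \in Mk k)) => //= nk; exact: (fsubsetP (exhausting_mono kl)).
Qed.

(** Meant for [quotient_sum]: as [0^-1 = 0], the quotients it filters out are already zero. *)
Lemma nnsum_mkcond (P : pred M) (a : M -> R) : (forall n, ~~ P n -> a n = 0) ->
  nnsum Mk P a = nnsum Mk predT a.
Proof.
move=> aP; rewrite /nnsum; suff /funext -> : (fun k => \sum_(n <- Mk k | P n) (a n)%:E)%E =1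
  (fun k => \sum_(n <- Mk k) (a n)%:E)%E by [].
move=> k; rewrite big_mkcond/=; apply: eq_bigr => n _.
by case: ifPn => // /aP ->.
Qed.

Lemma nnsum_cvg (a : M -> R) : (forall n, 0 <= a n) ->
  (\sum_(n <- Mk k) a n)%:E @[k --> \oo] --> nnsum Mk predT a.
Proof.
move=> a0.
have /ereal_nondecreasing_cvgn cv :
    {homo (fun k => (\sum_(n <- Mk k) a n)%:E) : k l / (k <= l)%N >-> (k <= l)%E}.
  by move=> k l kl; rewrite lee_fin ler_sum_exhausting.
rewrite /nnsum; under [X in limn X]eq_fun do rewrite sumEFin.
by rewrite (cvg_lim _ cv).
Qed.

Lemma nnsum_ge (a : M -> R) k : (forall n, 0 <= a n) ->
  ((\sum_(n <- Mk k) a n)%:E <= nnsum Mk predT a)%E.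
Proof.
move=> a0; rewrite -(cvg_lim _ (nnsum_cvg a0))//.
apply: lime_ge; first by apply/cvg_ex; eexists; exact: nnsum_cvg.
by exists k => // l /= kl; rewrite lee_fin ler_sum_exhausting.
Qed.

Lemma nnsum_le (a : M -> R) (B : \bar R) : (forall n, 0 <= a n) ->
  (forall k, (\sum_(n <- Mk k) a n)%:E <= B)%E -> (nnsum Mk predT a <= B)%E.
Proof.
move=> a0 aB; rewrite -(cvg_lim _ (nnsum_cvg a0))//.
apply: lime_le; first by apply/cvg_ex; eexists; exact: nnsum_cvg.
exact: nearW.
Qed.

Lemma nnsum_ge0 (a : M -> R) : (forall n, 0 <= a n) -> (0 <= nnsum Mk predT a)%E.
Proof.
by move=> a0; apply: le_trans (nnsum_ge 0 a0); rewrite lee_fin sumr_ge0.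
Qed.

Lemma nnsum_cvg_fin (a : M -> R) (B : R) : (forall n, 0 <= a n) ->
  nnsum Mk predT a = B%:E -> \sum_(n <- Mk k) a n @[k --> \oo] --> B.
Proof.
by move=> a0 aB; have := nnsum_cvg a0; rewrite aB => /fine_cvgP[].
Qed.

Lemma le_nnsum (a b : M -> R) : (forall n, 0 <= a n) -> (forall n, a n <= b n) ->
  (nnsum Mk predT a <= nnsum Mk predT b)%E.
Proof.
move=> a0 ab; have b0 n : 0 <= b n by exact: le_trans (ab n).
apply: nnsum_le => // k; apply: le_trans (nnsum_ge k b0).
by rewrite lee_fin ler_sum.
Qed.

End Sums.

(** * Orthonormal bases *)

Section Hilbert.
Context (R : realType) (H : hilbertSpace R) (M : countType) (e : M -> H).
Context (he : orthonormal_basis e).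
Implicit Types (x y : H) (s : seq M) (k : M -> R[i]).

Lemma inner_self x : inner H x x = (rnorm x ^+ 2)%:C%C.
Proof. by rewrite inner_norm rmorphXn/= -rnormE. Qed.

Lemma coefD x y n : coef e (x + y) n = coef e x n + coef e y n.
Proof. by rewrite /coef linearDl. Qed.

Lemma coefB x y n : coef e (x - y) n = coef e x n - coef e y n.
Proof. by rewrite /coef linearBl. Qed.

Lemma coefZ (z : R[i]) x n : coef e (z *: x) n = z * coef e x n.
Proof. by rewrite /coef linearZl_LR. Qed.

Lemma coef_basis m n : coef e (e m) n = (m == n)%:R.
Proof. exact: he.1. Qed.

Lemma coef_sum s k n : uniq s ->
  coef e (\sum_(m <- s) k m *: e m) n = if n \in s then k n else 0.
Proof.
move=> us; rewrite /coef linear_sumlz.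
under eq_bigr => m _ do rewrite linearZl_LR/= he.1.
case: ifPn => ns.
  rewrite (bigD1_seq n)//= eqxx mulr1 big1 ?addr0// => m /negPf ->.
  by rewrite mulr0.
rewrite big_seq big1// => m ms; case: eqVneq => [mn|_]; last by rewrite mulr0.
by rewrite mn (negPf ns) in ms.
Qed.

Lemma inner_sumr x s k : inner H x (\sum_(m <- s) k m *: e m) =
  \sum_(m <- s) coef e x m * Num.conj (k m).
Proof.
by rewrite linear_sumr; apply: eq_bigr => m _; rewrite linearZr_LR/= mulrC.
Qed.

Lemma rnorm_sum_basis s k : uniq s ->
  rnorm (\sum_(m <- s) k m *: e m) ^+ 2 = \sum_(m <- s) rnorm (k m : R[i]^o) ^+ 2.
Proof.
move=> us; apply: complexI; rewrite -inner_self inner_sumr rmorph_sum/=.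
by apply: eq_big_seq => m ms; rewrite coef_sum// ms mul_conj_rnorm.
Qed.

Definition proj s x : H := \sum_(n <- s) coef e x n *: e n.

(** Pythagoras: the residual [x - proj s x] has zero coefficients on [s], hence is orthogonal to
    [proj s x]. *)
Lemma bessel s x : uniq s ->
  rnorm (x - proj s x) ^+ 2 + \sum_(n <- s) rnorm (coef e x n : R[i]^o) ^+ 2 =
  rnorm x ^+ 2.
Proof.
move=> us; have ortho : inner H (x - proj s x) (proj s x) = 0.
  rewrite {2}/proj inner_sumr big1_seq// => n /= ns.
  by rewrite coefB coef_sum// ns subrr mul0r.
rewrite -rnorm_sum_basis//; apply: complexI.
by rewrite rmorphD/= -!inner_self -(hnormDd ortho) subrK.
Qed.

Lemma sum_coef_le s x : uniq s ->
  \sum_(n <- s) rnorm (coef e x n : R[i]^o) ^+ 2 <= rnorm x ^+ 2.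
Proof. by move=> us; rewrite -(bessel x us) lerDr sqr_ge0. Qed.

Lemma rnorm_subproj s x : uniq s -> rnorm (x - proj s x) <= rnorm x.
Proof.
move=> us; rewrite -(@ler_pXn2r _ 2) ?nnegrE ?rnorm_ge0// -(bessel x us) lerDl.
by apply: sumr_ge0 => n _; exact: sqr_ge0.
Qed.

Lemma projD s x y : proj s (x + y) = proj s x + proj s y.
Proof. by rewrite -big_split/=; apply: eq_bigr => n _; rewrite coefD scalerDl. Qed.

Lemma projZ s (z : R[i]) x : proj s (z *: x) = z *: proj s x.
Proof. by rewrite scaler_sumr; apply: eq_bigr => n _; rewrite coefZ scalerA. Qed.

Lemma projB s x y : proj s (x - y) = proj s x - proj s y.
Proof. by rewrite projD -scaleN1r projZ scaleN1r. Qed.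

Lemma proj_basis s m : uniq s -> m \in s -> proj s (e m) = e m.
Proof.
move=> us ms; rewrite /proj (bigD1_seq m)//= coef_basis eqxx scale1r.
rewrite big1 ?addr0// => n nm; rewrite coef_basis eq_sym (negPf nm).
by rewrite scale0r.
Qed.

Lemma proj_id s t k : uniq s -> {subset t <= s} ->
  proj s (\sum_(n <- t) k n *: e n) = \sum_(n <- t) k n *: e n.
Proof.
move=> us; elim: t => [|n t IH] ts.
  by rewrite big_nil /proj big1// => n _; rewrite /coef linear0l scale0r.
rewrite big_cons projD projZ proj_basis ?ts ?mem_head// IH// => m mt.
by rewrite ts// inE mt orbT.
Qed.

Context (Mk : nat -> {fset M}) (hMk : exhausting Mk).

(** Density gives a finite combination [y] of basis vectors close to [x]. Once [Mk k] contains the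
    indices of [y], the projection fixes [y], so the residuals of [x] and of [x - y] agree, and
    taking residuals does not increase the norm. *)
Lemma proj_cvg x : proj (Mk k) x @[k --> \oo] --> x.
Proof.
apply/cvgn_rnormP => eps eps0.
have [_ [s [c ->]] xy] : exists2 y, [set y | exists s c,
    y = \sum_(n <- s) c n *: e n] y & rnorm (x - y) <= eps.
  by apply: closure_rnormP => //; rewrite he.2.
have : \forall k \near \oo, all [in Mk k] s.
  elim: s {xy} => [|n s IH]; first exact: nearW.
  by near=> k => /=; apply/andP; split; near: k => //; exact: exhausting_near.
apply: filterS => k /allP sk.
move: xy; set y := \sum_(n <- s) _ => xy.
have -> : x - proj (Mk k) x = (x - y) - proj (Mk k) (x - y).
  by rewrite projB [in proj _ y]proj_id ?fset_uniq// opprB addrA subrK.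
exact: le_trans (rnorm_subproj _ (fset_uniq _)) xy.
Unshelve. all: by end_near. Qed.
End Hilbert.

(** * Seminorms of finite combinations of basis vectors *)

Section FiniteSupport.
Context (R : realType) (M : countType) (Mk : nat -> {fset M}).
Context (hMk : exhausting Mk).

Lemma nnsum_support (a : M -> R) k : (forall n, 0 <= a n) ->
  (forall n, n \notin Mk k -> a n = 0) ->
  nnsum Mk predT a = (\sum_(n <- Mk k) a n)%:E.
Proof.
move=> a0 ak; apply/le_anti/andP; split; last exact: nnsum_ge.
apply: nnsum_le => // l; rewrite lee_fin.
rewrite (big_fset_incl _ (exhausting_mono hMk (leq_maxl k l))) => [|n _ /ak//].
by rewrite ler_sum_exhausting ?leq_maxr.
Qed.

Context (H H' : hilbertSpace R) (e : M -> H) (he : orthonormal_basis e).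

Lemma nnsum_fincomb (w : M -> R) (b : M -> R[i]) k : (forall n, 0 <= w n) ->
  nnsum Mk predT (fun n =>
    rnorm (coef e (\sum_(m <- Mk k) b m *: e m) n : R[i]^o) ^+ 2 * w n) =
  (\sum_(n <- Mk k) rnorm (b n : R[i]^o) ^+ 2 * w n)%:E.
Proof.
move=> w0; rewrite (@nnsum_support _ k).
- congr EFin; apply: eq_big_seq => n nk.
  by rewrite coef_sum// ?fset_uniq// nk.
- by move=> n; rewrite mulr_ge0// sqr_ge0.
- move=> n nk; rewrite coef_sum ?fset_uniq// (negPf nk).
  by rewrite rnorm0 expr0n mul0r.
Qed.

Lemma wspace_fincomb (r : nat) (T : 'I_r.+1 -> operator H H') (b : M -> R[i]) k :
  wspace Mk e T (\sum_(m <- Mk k) b m *: e m).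
Proof. by move=> j; rewrite nnsum_fincomb ?ltry// => n; exact: sqr_ge0. Qed.

Lemma wseminorm_fincomb (w : M -> R) (b : M -> R[i]) k : (forall n, 0 <= w n) ->
  wseminorm Mk e w (\sum_(m <- Mk k) b m *: e m) =
  (Num.sqrt (\sum_(n <- Mk k) rnorm (b n : R[i]^o) ^+ 2 * w n))%:E.
Proof. by move=> w0; rewrite /wseminorm nnsum_fincomb. Qed.

End FiniteSupport.

(** * Convergence of coefficient series *)

Section CoefficientSeries.
Context (R : realType) (H : hilbertSpace R) (M : countType) (e : M -> H).
Context (he : orthonormal_basis e) (Mk : nat -> {fset M}) (hMk : exhausting Mk).

Lemma rnorm_coef_le x n : rnorm (coef e x n : R[i]^o) <= rnorm x.
Proof.
have := sum_coef_le he x (isT : uniq [:: n]).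
by rewrite big_seq1 ler_pXn2r// nnegrE rnorm_ge0.
Qed.

Lemma rnorm_coef_sum_le (s : seq M) (w : M -> R[i]) x (K : R) : uniq s -> 0 <= K ->
  \sum_(n <- s) rnorm (w n : R[i]^o) ^+ 2 <= K ^+ 2 ->
  rnorm (\sum_(n <- s) w n * coef e x n : R[i]^o) <= K * rnorm x.
Proof.
move=> us K0 wK; apply: (le_trans (ler_rnorm_sum _ _)).
under eq_bigr => n _ do rewrite rnormM.
apply: (le_trans (@weighted_cauchy_schwarz _ _ _ _ _ (fun=> 1) (fun=> ler01) _)).
  by move=> n /eqP; rewrite oner_eq0.
under eq_bigr => n _ do rewrite divr1.
under [X in _ * Num.sqrt X <= _]eq_bigr => n _ do rewrite mulr1.
rewrite ler_pM ?sqrtr_ge0//.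
  by rewrite -(ger0_norm K0) -sqrtr_sqr ler_wsqrtr.
by rewrite -(ger0_norm (rnorm_ge0 x)) -sqrtr_sqr ler_wsqrtr// sum_coef_le.
Qed.

(* The scalar field has no canonical structure of complete space; the partial
   sums are therefore carried into the line spanned by [e n0]. *)
Lemma coef_series_cvg (n0 : M) (w : M -> R[i]) (K : R) x : 0 <= K ->
  (forall k, \sum_(n <- Mk k) rnorm (w n : R[i]^o) ^+ 2 <= K ^+ 2) ->
  exists l : R[i]^o,
    (fun k => \sum_(n <- Mk k) w n * coef e x n : R[i]^o) @ \oo --> l.
Proof.
move=> K0 wK; pose z k : R[i]^o := \sum_(n <- Mk k) w n * coef e x n.
(* For [k <= l], the difference [z l - z k] is the [l]-th partial sum for the residual
   [x - proj e (Mk k) x], which tends to zero: this is the Cauchy property. *)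
have zlk k l : (k <= l)%N -> rnorm (z k - z l) <= K * rnorm (x - proj e (Mk k) x).
  move=> kl; rewrite rnormB.
  apply: le_trans (rnorm_coef_sum_le _ (fset_uniq _) K0 (wK l)).
  have -> : z k = \sum_(n <- Mk l) w n * (if n \in Mk k then coef e x n else 0).
    rewrite -(big_fset_incl _ (exhausting_mono hMk kl)) => [|n _ /negPf ->].
      by apply: eq_big_seq => n ->.
    by rewrite mulr0.
  rewrite -sumrB le_eqVlt; apply/orP; left; apply/eqP; congr rnorm.
  by apply: eq_bigr => n _; rewrite -mulrBr coefB coef_sum// fset_uniq.
have en0 : rnorm (e n0) = 1.
  apply/eqP; rewrite -(@eqrXn2 _ 2) ?rnorm_ge0// expr1n; apply/eqP/complexI.
  by rewrite -inner_self he.1 eqxx.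
have : cvg ((fun k => z k *: e n0) @ \oo).
  apply: cauchy_cvg; apply: cauchy_exP => eps eps0.
  have epsE : eps = (complex.Re eps)%:C%C by rewrite RRe_real// gtr0_real.
  move: eps0; rewrite epsE ltcR; set eps' := complex.Re eps => eps0.
  (* [K] may be zero, hence the division by [K + 1]. *)
  have K1 : 0 < K + 1 by rewrite ltr_wpDl.
  have := (cvgn_rnormP _ _).1 (proj_cvg he hMk (x:=x)) (eps' / (K + 1)).
  rewrite divr_gt0// => /(_ isT) [k0 _ /(_ k0 (leqnn _)) xk0].
  exists (z k0 *: e n0); exists k0 => // l /= k0l.
  rewrite -ball_normE/= -scalerBl rnormE ltcR rnormZ en0 mulr1.
  apply: (le_lt_trans (zlk _ _ k0l)).
  apply: (@le_lt_trans _ _ (K * (eps' / (K + 1)))); first by rewrite ler_wpM2l.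
  by rewrite mulrCA gtr_pMr// ltr_pdivrMr// mul1r ltrDl.
move=> /cvg_ex[v /cvgn_rnormP zv]; exists (coef e v n0); apply/cvgn_rnormP => eps eps0.
apply: filterS (zv _ eps0) => k; apply: le_trans.
have -> : coef e v n0 - \sum_(n <- Mk k) w n * coef e x n =
    coef e (v - z k *: e n0) n0.
  by rewrite coefB coefZ coef_basis// eqxx mulr1.
exact: rnorm_coef_le.
Qed.
End CoefficientSeries.

(** * Boundedness and series expansion of closable functionals *)

Section ClosableFunctional.
Context (R : realType) (H : hilbertSpace R).

Lemma op0 (V W : lmodType R[i]) (T : operator V W) : T 0 = 0.
Proof.
have := op_linear 1 (dom0 T) (dom0 T); rewrite scaler0 addr0 scale1r.
by move/eqP; rewrite -subr_eq subrr => /eqP.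
Qed.

(** If [g] is unbounded, there are arbitrarily short vectors [x / g x] on which [g] equals 1. Then
    [(0, 1)] lies in the closure of the graph, which contradicts [T' 0 = 0]. *)
Lemma closable_functional_bounded (g : operator H (R[i]^o)) : closable g ->
  exists2 K : R, 0 <= K & forall x, dom g x -> rnorm (g x) <= K * rnorm x.
Proof.
move=> [T' gT']; apply: contrapT => unb.
suff [_ /=] : op_graph T' (0, 1) by rewrite op0 => /eqP; rewrite oner_eq0.
rewrite -gT' => U [[/= U1 U2] [U10 U21] U12].
have [eps /= eps0 epsU1] := (nbhs_ballP _ _).1 U10.
have epsE : eps = (complex.Re eps)%:C%C by rewrite RRe_real// gtr0_real.
move: eps0 epsU1; rewrite epsE ltcR; set r := complex.Re eps => r0 rU1.
have [x gx xlt] : exists2 x, dom g x & r^-1 * rnorm x < rnorm (g x).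
  apply: contrapT => unb'; apply: unb; exists r^-1; first by rewrite invr_ge0 ltW.
  by move=> x gx; rewrite leNgt; apply/negP => xlt; apply: unb'; exists x.
have gx_gt0 : 0 < rnorm (g x).
  by apply: le_lt_trans xlt; rewrite mulr_ge0 ?rnorm_ge0// invr_ge0 ltW.
have gx0 : g x != 0 by rewrite -rnorm_eq0 gt_eqF.
have gy : g ((g x : R[i])^-1 *: x + 0) = 1.
  rewrite op_linear//; last exact: dom0.
  rewrite op0 addr0; exact: mulVf.
rewrite addr0 in gy.
exists ((g x : R[i])^-1 *: x, 1); split.
  by split=> /=; [rewrite -[_ *: _]addr0; apply: domP => //; exact: dom0|rewrite gy].
apply: U12; split => /=; last exact: nbhs_singleton.
apply: rU1; rewrite -ball_normE/= sub0r normrN rnormE ltcR rnormZ.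
have : rnorm ((g x : R[i])^-1 : R[i]^o) * rnorm (g x) = 1.
  by rewrite -rnormM mulVf// (rnormC 1) normr1.
move: gx_gt0 xlt; set t := rnorm (_^-1); move: (rnorm (g x)) => u u0 xlt tu.
have -> : t = u^-1 by rewrite -[LHS]mulr1 -(divff (lt0r_neq0 u0)) mulrA tu mul1r.
by rewrite mulrC ltr_pdivrMr// -ltr_pdivrMl.
Qed.

Lemma op_fincomb (M : countType) (e : M -> H) (W : lmodType R[i])
    (T : operator H W) (s : seq M) (b : M -> R[i]) :
  (forall n, dom T (e n)) ->
  dom T (\sum_(n <- s) b n *: e n) /\
  T (\sum_(n <- s) b n *: e n) = \sum_(n <- s) b n *: T (e n).
Proof.
move=> Te; elim: s => [|n s [dT IH]].
  rewrite !big_nil; split; first exact: dom0.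
  exact: op0.
rewrite !big_cons; split; first exact: domP.
by rewrite op_linear// IH.
Qed.

Context (M : countType) (e : M -> H) (he : orthonormal_basis e).
Context (Mk : nat -> {fset M}) (hMk : exhausting Mk).
Context (g : operator H (R[i]^o)) (ge : forall n, dom g (e n)).
Context (K : R) (K0 : 0 <= K) (gK : forall x, dom g x -> rnorm (g x) <= K * rnorm x).

(** Test [g] on the vector [y] with coefficients conj(g(e_n)): if [Q] is the sum, then [g y = Q] and
    the squared norm of [y] is [Q], so that [Q <= K * sqrt Q]. *)
Lemma bounded_sum_sqr (s : seq M) : uniq s ->
  \sum_(n <- s) rnorm (g (e n)) ^+ 2 <= K ^+ 2.
Proof.
move=> us.
have [dy gy] := op_fincomb s (fun n => Num.conj (g (e n) : R[i])) ge.
have := gK dy; rewrite gy.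
have -> : \sum_(n <- s) (Num.conj (g (e n) : R[i])) *: g (e n) =
    (\sum_(n <- s) rnorm (g (e n)) ^+ 2)%:C%C.
  by rewrite rmorph_sum/=; apply: eq_bigr => n _; rewrite -mul_conj_rnorm mulrC.
rewrite rnormC => le1; have := rnorm_sum_basis he (fun n => Num.conj (g (e n) : R[i])) us.
under [X in _ = X -> _]eq_bigr => n _ do rewrite rnorm_conj.
have := rnorm_ge0 (\sum_(m <- s) Num.conj (g (e m) : R[i]) *: e m).
move: le1; move: (rnorm (\sum_(m <- s) _)) => y; set Q := \sum_(n <- s) _.
have Q0 : 0 <= Q by apply: sumr_ge0 => n _; exact: sqr_ge0.
rewrite ger0_norm// => QKy y0 yQ.
rewrite -yQ ler_pXn2r//.
have [->//|yn0] := eqVneq y 0.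
have {}y0 : 0 < y by rewrite lt_neqAle eq_sym yn0.
by rewrite -(ler_pM2r y0) -expr2 yQ.
Qed.

(** The error of the [k]-th partial sum is [g] at the residual [x - proj e (Mk k) x], which tends to
    zero and stays in the domain. *)
Lemma bounded_functional_series x : dom g x ->
  (fun k => \sum_(n <- Mk k) g (e n) * coef e x n : R[i]^o) @ \oo --> g x.
Proof.
move=> gx; apply/cvgn_rnormP => eps eps0.
have K1 : 0 < K + 1 by rewrite ltr_wpDl.
have := (cvgn_rnormP _ _).1 (proj_cvg he hMk (x:=x)) (eps / (K + 1)).
rewrite divr_gt0// => /(_ isT); apply: filterS => k xk.
have [dp gp] := op_fincomb (Mk k) (coef e x) ge.
have xE : x - proj e (Mk k) x = -1 *: proj e (Mk k) x + x.
  by rewrite scaleN1r addrC.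
have dx : dom g (x - proj e (Mk k) x) by rewrite xE; exact: domP.
have -> : g x - \sum_(n <- Mk k) g (e n) * coef e x n = g (x - proj e (Mk k) x).
  rewrite xE (op_linear (-1) dp gx) gp scaleN1r addrC; congr (- _ + _).
  by apply: eq_bigr => n _; rewrite mulrC.
apply: (le_trans (gK dx)); apply: (@le_trans _ _ (K * (eps / (K + 1)))).
  by rewrite ler_wpM2l.
by rewrite mulrCA ler_piMr ?(ltW eps0)// ler_pdivrMr// mul1r lerDl.
Qed.

End ClosableFunctional.

(** * The functionals [Gmu] *)

Section SeriesBound.
Context (R : realType).

Lemma rnorm_lim_le (V : normedModType R[i]) (u : V^nat) (l : V) (B : R) :
  u @ \oo --> l -> (forall k, rnorm (u k) <= B) -> rnorm l <= B.
Proof.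
move=> ul uB; apply/ler_addgt0Pr => eps eps0.
have [k _ /(_ k (leqnn _)) lk] := (cvgn_rnormP _ _).1 ul _ eps0.
rewrite -(subrK (u k) l) addrC (le_trans (ler_rnormD _ _))// lerD//.
Qed.

Context (H : hilbertSpace R) (M : countType) (e : M -> H).
Context (Mk : nat -> {fset M}) (hMk : exhausting Mk).

(** Weighted Cauchy-Schwarz on each partial sum, then passage to the limit. It serves both upper
    bounds: with the weight [c] for the norm of [Gmu], and with the weight [d] for its deviation. *)
Lemma coef_series_bound (w : M -> R[i]) (v : M -> R) (x : H) (l : R[i]^o) (Q s : R) :
  (forall n, 0 <= v n) -> (forall n, v n = 0 -> w n = 0) -> 0 <= Q ->
  (forall k, \sum_(n <- Mk k) rnorm (w n : R[i]^o) ^+ 2 / v n <= Q ^+ 2) ->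
  (fun k => \sum_(n <- Mk k) w n * coef e x n : R[i]^o) @ \oo --> l ->
  (wseminorm Mk e v x <= s%:E)%E -> rnorm l <= Q * s.
Proof.
move=> v0 vw Q0 wQ ul xs; apply: (rnorm_lim_le ul) => k.
apply: (le_trans (ler_rnorm_sum _ _)).
under eq_bigr => n _ do rewrite rnormM.
apply: (le_trans (@weighted_cauchy_schwarz _ _ _ _ _ v v0 _)).
  by move=> n /vw ->; rewrite rnorm0.
rewrite ler_pM ?sqrtr_ge0//.
  by rewrite -(ger0_norm Q0) -sqrtr_sqr ler_wsqrtr.
rewrite -lee_fin; apply: le_trans xs.
have vx n : 0 <= rnorm (coef e x n : R[i]^o) ^+ 2 * v n by rewrite mulr_ge0// sqr_ge0.
rewrite -[leLHS]/(sqrte (\sum_(n <- Mk k) _)%:E) lee_sqrt; last exact: nnsum_ge0.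
exact: nnsum_ge.
Qed.

(** [fun_norm] only sees the unit ball, so the vector has to be rescaled into it; a vector of zero
    seminorm needs a separate argument. *)
Lemma fun_norm_fincomb (he : orthonormal_basis e) (H' : hilbertSpace R) (r : nat)
    (T : 'I_r.+1 -> operator H H') (c : M -> R) (S : H -> R[i]^o) (N : R)
    (b : M -> R[i]) k :
  (forall n, 0 <= c n) -> linear_on (wspace Mk e T) S -> 0 <= N ->
  (fun_norm (wspace Mk e T) (wseminorm Mk e c) S <= N%:E)%E ->
  rnorm (S (\sum_(n <- Mk k) b n *: e n)) <=
  N * Num.sqrt (\sum_(n <- Mk k) rnorm (b n : R[i]^o) ^+ 2 * c n).
Proof.
move=> c0 linS N0 SN; set s := Num.sqrt _; set y := \sum_(n <- _) _.
have HCcomb b' : wspace Mk e T (\sum_(n <- Mk k) b' n *: e n) by exact: wspace_fincomb.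
have HC0 : wspace Mk e T 0.
  by have := HCcomb (fun=> 0); rewrite big1// => n _; rewrite scale0r.
have S0 : S 0 = 0.
  have := linS 1 _ _ HC0 HC0; rewrite scaler0 addr0 scale1r.
  by move/eqP; rewrite -subr_eq subrr => /eqP.
have scaled (t : R) : 0 <= t -> t * s <= 1 -> t * rnorm (S y) <= N.
  move=> t0 ts; rewrite -lee_fin; apply: le_trans SN.
  apply: ereal_sup_ubound; exists (t%:C%C *: y) => /=.
    have -> : t%:C%C *: y = \sum_(n <- Mk k) (t%:C%C * b n) *: e n.
      by rewrite scaler_sumr; apply: eq_bigr => n _; rewrite scalerA.
    split => //; rewrite wseminorm_fincomb// lee_fin.
    rewrite [X in Num.sqrt X](_ : _ =
        t ^+ 2 * \sum_(n <- Mk k) rnorm (b n : R[i]^o) ^+ 2 * c n).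
      by rewrite sqrtrM ?sqr_ge0// sqrtr_sqr ger0_norm.
    by rewrite mulr_sumr; apply: eq_bigr => n _; rewrite rnormM rnormC exprMn ger0_norm// mulrA.
  have := linS t%:C%C _ _ (HCcomb b) HC0; rewrite addr0 S0 addr0 => ->.
  by rewrite rnormM rnormC ger0_norm.
(* If [s = 0], every multiple of [y] is in the unit ball; were [S y] nonzero, the factor
   [(N + 1) / rnorm (S y)] would give [N + 1 <= N]. *)
have [s0|sn0] := eqVneq s 0.
  rewrite s0 mulr0 leNgt; apply/negP => Sy.
  have := scaled ((N + 1) / rnorm (S y)).
  rewrite s0 mulr0 ler01 divr_ge0 ?addr_ge0// ?rnorm_ge0// => /(_ isT isT).
  by rewrite divfK ?gt_eqF// gerDl ler10.
have s_gt0 : 0 < s by rewrite lt_neqAle eq_sym sn0 sqrtr_ge0.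
have := scaled s^-1; rewrite invr_ge0 ltW// mulVf// lexx => /(_ isT isT).
by rewrite mulrC ler_pdivrMr.
Qed.

End SeriesBound.

(** * Series expansion and norm of [Gmu] *)

Section Gmu.
Context (R : realType) (H H' : hilbertSpace R) (M : countType) (e : M -> H).
Context (he : orthonormal_basis e) (Mk : nat -> {fset M}) (hMk : exhausting Mk).
Context (n0 : M) (p : nat) (C : 'I_p.+1 -> operator H H').
Context (a : M -> R[i]^o) (c d : M -> R) (mu K : R).
Context (c0 : forall n, 0 <= c n) (d0 : forall n, 0 <= d n) (mu0 : 0 <= mu).
Context (K0 : 0 <= K).
Context (aK : forall k, \sum_(n <- Mk k) rnorm (a n) ^+ 2 <= K ^+ 2).

Let G := Gmu Mk e a c d mu.
Let HC := wspace Mk e C.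
Let r n := c n / (c n + mu * d n).

Lemma ratio_ge0 n : 0 <= r n.
Proof. by rewrite divr_ge0// addr_ge0// mulr_ge0. Qed.

Lemma ratio_le1 n : r n <= 1.
Proof.
have [cd0|cd0] := eqVneq (c n + mu * d n) 0; first by rewrite /r cd0 invr0 mulr0.
rewrite /r ler_pdivrMr ?mul1r ?lerDl ?mulr_ge0//.
by rewrite lt_neqAle eq_sym cd0 addr_ge0// mulr_ge0.
Qed.

(** Since [0^-1 = 0], the omitted terms have [r n = 0] and may be restored. As [0 <= r n <= 1], the
    coefficients [a n * r n] are square summable along with [a n], so the series converges on all of
    [H]. *)
Lemma Gmu_cvg x :
  (fun k => \sum_(n <- Mk k) (a n * (r n)%:C%C) * coef e x n : R[i]^o) @ \oo --> G x.
Proof.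
have rK k : \sum_(n <- Mk k) rnorm (a n * (r n)%:C%C : R[i]^o) ^+ 2 <= K ^+ 2.
  apply: le_trans (aK k); apply: ler_sum => n _.
  rewrite rnormM rnormC ger0_norm ?ratio_ge0// exprMn ler_piMr ?sqr_ge0//.
  by rewrite expr_le1 ?ratio_ge0// ratio_le1.
have [l ul] := coef_series_cvg he hMk n0 x K0 rK.
suff -> : G x = l by [].
rewrite /G /Gmu /csum; apply: cvg_lim => //.
apply: cvg_trans ul; apply: near_eq_cvg; apply: nearW => k /=.
rewrite [RHS]big_mkcond/=; apply: eq_bigr => n _.
case: ifPn => [_|/negPn/eqP cd0]; first by rewrite /r -mulrA rmorphM/= fmorphV/= !mulrA.
by rewrite /r cd0 invr0 mulr0 mulr0 mul0r.
Qed.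

Lemma Gmu_linear : linear_on HC G.
Proof.
move=> z x y _ _; rewrite -(cvg_lim _ (Gmu_cvg (x := z *: x + y)))//; apply: cvg_lim => //.
apply: cvg_trans (cvgD (cvgZl_tmp (k := z) (Gmu_cvg (x := x))) (Gmu_cvg (x := y))).
apply: near_eq_cvg; apply: nearW => k /=.
rewrite fctE/= scaler_sumr -big_split/=; apply: eq_bigr => n _.
by rewrite coefD coefZ mulrDr mulrCA.
Qed.

Lemma Gmu_fincomb (b : M -> R[i]) k :
  G (\sum_(n <- Mk k) b n *: e n) = \sum_(n <- Mk k) a n * (r n)%:C%C * b n.
Proof.
rewrite -(cvg_lim _ (Gmu_cvg (x := _)))//; apply: cvg_lim => //; apply: cvg_near_cst.
exists k => // l /= kl.
rewrite -(big_fset_incl _ (exhausting_mono hMk kl)) => [|n _ nk].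
  by apply: eq_big_seq => n nk; rewrite coef_sum ?fset_uniq// nk.
by rewrite coef_sum ?fset_uniq// (negPf nk) mulr0.
Qed.

Context (N : R) (GN : fun_norm HC (wseminorm Mk e c) G = N%:E).

Lemma Gmu_norm_ge0 : 0 <= N.
Proof.
rewrite -lee_fin -GN; apply: (@le_trans _ _ (rnorm (G 0))%:E).
  by rewrite lee_fin rnorm_ge0.
have zero k : \sum_(n <- Mk k) (0 : R[i]) *: e n = 0.
  by rewrite big1// => n _; rewrite scale0r.
apply: ereal_sup_ubound; exists 0 => //; split.
  by have := wspace_fincomb hMk he C (fun=> 0) 0; rewrite zero.
have := wseminorm_fincomb hMk he (fun=> 0) 0 c0; rewrite zero => ->.
by rewrite big1 ?sqrtr0// => n _; rewrite rnorm0 expr0n mul0r.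
Qed.

(** Test [G] on the coefficients conj(a_n) r_n / c_n: both the value of [G] and the squared seminorm
    equal the sum [Q], whence [Q <= N * sqrt Q]. *)
Lemma Gmu_norm_sum_le k : \sum_(n <- Mk k) (rnorm (a n) * r n) ^+ 2 / c n <= N ^+ 2.
Proof.
have GN' : (fun_norm HC (wseminorm Mk e c) G <= N%:E)%E by rewrite GN.
have := fun_norm_fincomb hMk he (fun n => Num.conj (a n : R[i]) * (r n / c n)%:C%C) k
  c0 Gmu_linear Gmu_norm_ge0 GN'.
rewrite Gmu_fincomb; set Q := (leLHS in leLHS <= N ^+ 2).
have -> : \sum_(n <- Mk k) a n * (r n)%:C%C *
    (Num.conj (a n : R[i]) * (r n / c n)%:C%C) = Q%:C%C.
  rewrite rmorph_sum/=; apply: eq_bigr => n _.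
  by rewrite mulrACA mul_conj_rnorm -!rmorphM/= exprMn expr2 !mulrA.
have -> : \sum_(n <- Mk k) rnorm (Num.conj (a n : R[i]) * (r n / c n)%:C%C : R[i]^o) ^+ 2 * c n = Q.
  apply: eq_bigr => n _; rewrite rnormM rnorm_conj rnormC.
  rewrite ger0_norm; last by rewrite divr_ge0 ?ratio_ge0.
  have [cn0|cn0] := eqVneq (c n) 0; first by rewrite cn0 invr0 !mulr0.
  by field.
have Q0 : 0 <= Q by apply: sumr_ge0 => n _; rewrite divr_ge0// sqr_ge0.
rewrite rnormC ger0_norm// -{1 3}(sqr_sqrtr Q0).
have := sqrtr_ge0 Q; have := Gmu_norm_ge0.
move: (Num.sqrt Q) => q N0; rewrite le_eqVlt => /predU1P[<-|q0].
  by rewrite expr0n sqr_ge0.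
by rewrite {1}expr2 ler_pM2r// ler_pXn2r// nnegrE ltW.
Qed.

(** One inequality comes from the truncated test vectors, the other from weighted Cauchy-Schwarz,
    which bounds [G] on the unit ball by the root of the sum. *)
Lemma Gmu_norm_sum :
  nnsum Mk predT (fun n => (rnorm (a n) * r n) ^+ 2 / c n) = (N ^+ 2)%:E.
Proof.
set q := fun n => _; have q0 n : 0 <= q n by rewrite divr_ge0// sqr_ge0.
have N0 := Gmu_norm_ge0.
have le1 : (nnsum Mk predT q <= (N ^+ 2)%:E)%E.
  by apply: nnsum_le => // k; rewrite lee_fin Gmu_norm_sum_le.
apply/le_anti/andP; split => //.
have ge0 := nnsum_ge0 hMk q0.
have fin : nnsum Mk predT q \is a fin_num.
  by rewrite ge0_fin_numE// (le_lt_trans le1)// ltry.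
set Q := nnsum _ _ _ in fin ge0 *.
rewrite -(fineK fin) lee_fin -(sqr_sqrtr (fine_ge0 ge0)) ler_pXn2r ?nnegrE ?sqrtr_ge0//.
rewrite -lee_fin -GN; apply: ge_ereal_sup => _ [x [HCx xc] <-].
rewrite lee_fin -[leRHS]mulr1.
apply: (@coef_series_bound R H M e Mk hMk (fun n => a n * (r n)%:C%C) c x).
- by [].
- by move=> n cn; rewrite /r cn mul0r mulr0.
- exact: sqrtr_ge0.
- move=> k; rewrite sqr_sqrtr ?fine_ge0// -lee_fin (fineK fin).
  apply: le_trans (nnsum_ge hMk k q0); rewrite lee_fin.
  by apply: ler_sum => n _; rewrite rnormM rnormC ger0_norm ?ratio_ge0.
- exact: Gmu_cvg.
- exact: xc.
Qed.

Lemma Gmu_approximant : approximants HC (wseminorm Mk e c) N G.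
Proof.
split; [exact: Gmu_linear| |by rewrite GN].
have N0 := Gmu_norm_ge0.
(* [N + 1] is positive even when [N = 0], so that an infinite seminorm gives the bound [+oo] and not
   [0 * +oo = 0]. *)
exists (N + 1) => x HCx.
have : (0 <= wseminorm Mk e c x)%E by exact: sqrte_ge0.
case xs : (wseminorm Mk e c x) => [s| |]//; last first.
  by rewrite gt0_muley ?leey// lte_fin ltr_wpDl.
rewrite lee_fin => s0; rewrite lee_fin; apply: (@le_trans _ _ (N * s)).
  apply: (@coef_series_bound R H M e Mk hMk (fun n => a n * (r n)%:C%C) c x).
  - by [].
  - by move=> n cn; rewrite /r cn mul0r mulr0.
  - by [].
  - move=> k; apply: le_trans (Gmu_norm_sum_le k).
    by apply: ler_sum => n _; rewrite rnormM rnormC ger0_norm ?ratio_ge0.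
  - exact: Gmu_cvg.
  - by rewrite xs.
by rewrite ler_wpM2r// lerDl.
Qed.

End Gmu.

(** * Best approximation *)

Section Deviation.
Context (R : realType) (H H' : hilbertSpace R) (M : countType) (e : M -> H).
Context (he : orthonormal_basis e) (Mk : nat -> {fset M}) (hMk : exhausting Mk).
Context (n0 : M) (p q : nat) (C : 'I_p.+1 -> operator H H') (D : 'I_q.+1 -> operator H H').
Context (g : operator H (R[i]^o)) (ge : forall n, dom g (e n)) (K : R).
Context (K0 : 0 <= K) (gK : forall x, dom g x -> rnorm (g x) <= K * rnorm x).
Context (c d : M -> R) (mu N : R).
Context (c0 : forall n, 0 <= c n) (d0 : forall n, 0 <= d n) (mu0 : 0 <= mu).

Let a n := g (e n).
Let G := Gmu Mk e a c d mu.
Let HC := wspace Mk e C.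
Let r n := c n / (c n + mu * d n).
Let W := [set x | [/\ dom g x, HC x, wspace Mk e D x & (wseminorm Mk e d x <= 1)%E]].

Context (GN : fun_norm HC (wseminorm Mk e c) G = N%:E).
(** [tau] is kept abstract so that [mu > 0] and [mu = 0], where it has different formulas, share one
    argument. The two identities in [tauP] make all sums over the test vectors computable. *)
Context (tau : M -> R) (tau0 : forall n, 0 <= tau n).
Context (tauP : forall n, a n != 0 -> 1 - r n = tau n * d n /\ mu * r n = tau n * c n).
Context (E : R).
Context (EP : nnsum Mk predT (fun n => (rnorm (a n) * (1 - r n)) ^+ 2 / d n) = E%:E).

Let aK k : \sum_(n <- Mk k) rnorm (a n) ^+ 2 <= K ^+ 2.
Proof. exact: (bounded_sum_sqr he ge K0 gK (fset_uniq _)). Qed.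

Let E_term_ge0 n : 0 <= (rnorm (a n) * (1 - r n)) ^+ 2 / d n.
Proof. by rewrite divr_ge0// sqr_ge0. Qed.

Let E0 : 0 <= E.
Proof. by rewrite -lee_fin -EP; apply: nnsum_ge0. Qed.

Let residual0 n : d n = 0 -> a n * (1 - r n)%:C%C = 0.
Proof.
move=> dn; have [->|/tauP[-> _]] := eqVneq (a n) 0; first by rewrite mul0r.
by rewrite dn mulr0 mulr0.
Qed.

(** On [W] the difference [g x - G x] is the series with coefficients [a n * (1 - r n)]; apply
    Cauchy-Schwarz with the weight [d]. *)
Lemma deviation_Gmu_le : (deviation W g G <= (Num.sqrt E)%:E)%E.
Proof.
apply: ge_ereal_sup => _ [x [gx HCx HDx xd] <-].
rewrite lee_fin -[leRHS]mulr1.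
apply: (@coef_series_bound R H M e Mk hMk (fun n => a n * (1 - r n)%:C%C) d x) => //.
- move=> k; rewrite sqr_sqrtr// -lee_fin -EP.
  apply: le_trans (nnsum_ge hMk k E_term_ge0); rewrite lee_fin.
  apply: ler_sum => n _; rewrite rnormM rnormC ger0_norm//.
  by rewrite subr_ge0 ratio_le1.
- apply: cvg_trans (cvgB (bounded_functional_series he hMk ge K0 gK gx)
    (Gmu_cvg he hMk n0 c0 d0 mu0 K0 aK (x := x))).
  apply: near_eq_cvg; apply: nearW => k /=; rewrite fctE/= -sumrB.
  by apply: eq_bigr => n _; rewrite rmorphB/= mulrBr mulr1 mulrBl.
Qed.

Let NF k := \sum_(n <- Mk k) (rnorm (a n) * r n) ^+ 2 / c n.
Let DF k := \sum_(n <- Mk k) (rnorm (a n) * (1 - r n)) ^+ 2 / d n.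

Let NF0 k : 0 <= NF k.
Proof. by apply: sumr_ge0 => n _; rewrite divr_ge0// sqr_ge0. Qed.

Let DF0 k : 0 <= DF k.
Proof. by apply: sumr_ge0 => n _; exact: E_term_ge0. Qed.

(** By [tau n * c n = mu * r n]. This is the squared seminorm with weight [c] of the test vector
    with coefficients conj(a_n) tau_n; the next two sums are its squared seminorm with weight [d]
    and the value of [g] on it. *)
Let sum_tauC k : \sum_(n <- Mk k) (rnorm (a n) * tau n) ^+ 2 * c n = mu ^+ 2 * NF k.
Proof.
rewrite mulr_sumr; apply: eq_bigr => n _.
have [->|/tauP[_ tr]] := eqVneq (a n) 0; first by rewrite rnorm0 !mul0r expr0n !mul0r mulr0.
have [cn|cn] := eqVneq (c n) 0; first by rewrite cn invr0 !mulr0.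
have -> : tau n = mu * r n / c n by rewrite tr mulfK.
by field.
Qed.

Let sum_tauD k : \sum_(n <- Mk k) (rnorm (a n) * tau n) ^+ 2 * d n = DF k.
Proof.
apply: eq_bigr => n _.
have [->|/tauP[tr _]] := eqVneq (a n) 0; first by rewrite rnorm0 !mul0r expr0n !mul0r.
have [dn|dn] := eqVneq (d n) 0; first by rewrite dn invr0 !mulr0.
by rewrite tr mulrA [in RHS]exprMn expr2 !mulrA mulfK.
Qed.

(** Split [tau n] into [tau n * r n] and [tau n * (1 - r n)]; the two identities of [tauP] turn the
    parts into the terms of [mu * NF k] and [DF k]. *)
Let sum_tau k : \sum_(n <- Mk k) rnorm (a n) ^+ 2 * tau n = mu * NF k + DF k.
Proof.
rewrite mulr_sumr -big_split/=; apply: eq_bigr => n _.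
have [->|/tauP[tr tc]] := eqVneq (a n) 0.
  by rewrite rnorm0 !mul0r expr0n !mul0r mulr0 addr0.
have -> : mu * ((rnorm (a n) * r n) ^+ 2 / c n) = rnorm (a n) ^+ 2 * (tau n * r n).
  have [cn|cn] := eqVneq (c n) 0; first by rewrite /r cn invr0 !mul0r !mulr0.
  have -> : tau n = mu * r n / c n by rewrite tc mulfK.
  by field.
have -> : (rnorm (a n) * (1 - r n)) ^+ 2 / d n = rnorm (a n) ^+ 2 * (tau n * (1 - r n)).
  have [dn|dn] := eqVneq (d n) 0; first by rewrite tr dn invr0 !mulr0.
  by rewrite tr; field.
by rewrite -mulrDr -mulrDr addrC subrK mulr1.
Qed.

(* The test vectors [\sum_(n <- Mk k) (a n)^* * tau n *: e n] are asymptotically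
   extremal for both [G] and the deviation. *)
Let deviation_truncated (S : H -> R[i]^o) (v : R) k :
  approximants HC (wseminorm Mk e c) N S -> (deviation W g S <= v%:E)%E ->
  mu * NF k + DF k - N * (mu * Num.sqrt (NF k)) <= v * Num.sqrt (DF k).
Proof.
move=> [linS _ SN] Sv.
have N0 : 0 <= N by exact: (Gmu_norm_ge0 he hMk c0 GN).
(* If [DF k = 0] the test vector cannot be normalised, but the left-hand side is then
   [mu * sqrt (NF k) * (sqrt (NF k) - N)], which is at most zero. *)
have [D0|D0] := eqVneq (DF k) 0.
  have := Gmu_norm_sum_le he hMk n0 c0 d0 mu0 K0 aK GN k.
  rewrite -/(NF k) => NN; rewrite D0 sqrtr0 mulr0 addr0 mulrCA -mulrBr.
  rewrite mulr_ge0_le0// subr_le0 -{1}(sqr_sqrtr (NF0 k)) expr2 ler_wpM2r ?sqrtr_ge0//.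
  by rewrite -(ger0_norm N0) -sqrtr_sqr ler_wsqrtr.
have s_gt0 : 0 < Num.sqrt (DF k) by rewrite sqrtr_gt0 lt_neqAle eq_sym D0 DF0.
set s := Num.sqrt (DF k) in s_gt0 *.
(* Division by [s] gives the test vector seminorm 1 for the weight [d], which puts it in [W]. *)
pose b n : R[i] := Num.conj (a n : R[i]) * (tau n / s)%:C%C.
have rb n : rnorm (b n : R[i]^o) ^+ 2 = (rnorm (a n) * tau n) ^+ 2 / s ^+ 2.
  rewrite rnormM rnorm_conj rnormC ger0_norm ?divr_ge0 ?(ltW s_gt0)//.
  by rewrite mulrA exprMn exprVn.
have [dy gy] := op_fincomb (Mk k) b ge.
set y := \sum_(n <- Mk k) b n *: e n in dy gy.
have gyE : g y = ((mu * NF k + DF k) / s)%:C%C.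
  rewrite gy -sum_tau mulr_suml rmorph_sum/=; apply: eq_bigr => n _.
  rewrite /b [_ *: _]mulrC mulrA mul_conj_rnorm -rmorphM/=; congr (_%:C%C).
  by rewrite mulrA.
have Wy : W y.
  split => //; try exact: wspace_fincomb.
  rewrite wseminorm_fincomb// lee_fin.
  under eq_bigr => n _ do rewrite rb mulrAC.
  rewrite -mulr_suml sum_tauD -[X in X / _]sqr_sqrtr// -/s divff ?sqrtr1//.
  by rewrite expf_neq0// gt_eqF.
have := fun_norm_fincomb hMk he b k c0 linS N0 SN; rewrite -/y.
under eq_bigr => n _ do rewrite rb mulrAC.
rewrite -mulr_suml sum_tauC sqrtrM ?mulr_ge0 ?sqr_ge0// sqrtrM ?sqr_ge0// sqrtr_sqr.
rewrite sqrtrV ?sqr_ge0// sqrtr_sqr !ger0_norm ?(ltW s_gt0)// => Sy.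
have gSy : rnorm (g y - S y) <= v.
  by rewrite -lee_fin; apply: le_trans Sv; apply: ereal_sup_ubound; exists y.
have Q0 : 0 <= (mu * NF k + DF k) / s.
  by rewrite divr_ge0 ?(ltW s_gt0)// addr_ge0// mulr_ge0.
have : rnorm (g y) <= v + N * (mu * Num.sqrt (NF k) / s).
  by rewrite -(subrK (S y) (g y)) (le_trans (ler_rnormD _ _))// lerD.
rewrite gyE rnormC ger0_norm// -lerBlDr mulrA -mulrBl ler_pdivrMr//.
Qed.

(** Pass to the limit in [deviation_truncated]: [NF k] tends to [N ^+ 2] because [N] is exactly the
    norm of [G], so the terms with [mu] cancel and [E <= v * sqrt E] remains. *)
Lemma deviation_ge (S : H -> R[i]^o) :
  approximants HC (wseminorm Mk e c) N S -> ((Num.sqrt E)%:E <= deviation W g S)%E.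
Proof.
move=> SN.
have W0 : W 0.
  have zero : \sum_(n <- Mk 0) (0 : R[i]) *: e n = 0.
    by rewrite big1// => n _; rewrite scale0r.
  split; first exact: dom0.
  - by have := wspace_fincomb hMk he C (fun=> 0) 0; rewrite zero.
  - by have := wspace_fincomb hMk he D (fun=> 0) 0; rewrite zero.
  - have := wseminorm_fincomb hMk he (fun=> 0) 0 d0; rewrite zero => ->.
    by rewrite big1 ?sqrtr0// => n _; rewrite rnorm0 expr0n mul0r.
(* This settles the case [E = 0], where one cannot divide by [sqrt E]. *)
have dev0 : (0 <= deviation W g S)%E.
  apply: (@le_trans _ _ (rnorm (g 0 - S 0))%:E); first by rewrite lee_fin rnorm_ge0.
  by apply: ereal_sup_ubound; exists 0.
case dv : (deviation W g S) dev0 => [v| |]//; last by rewrite !leey.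
rewrite !lee_fin => v0.
have Sv : (deviation W g S <= v%:E)%E by rewrite dv.
have N0 : 0 <= N by exact: (Gmu_norm_ge0 he hMk c0 GN).
have NFN : NF k @[k --> \oo] --> N ^+ 2.
  apply: (nnsum_cvg_fin hMk); first by move=> n; rewrite divr_ge0// sqr_ge0.
  exact: (Gmu_norm_sum he hMk n0 c0 d0 mu0 K0 aK GN).
have DFE : DF k @[k --> \oo] --> E by exact: (nnsum_cvg_fin hMk E_term_ge0 EP).
have sNF : Num.sqrt (NF k) @[k --> \oo] --> N.
  rewrite -[X in _ --> X](ger0_norm N0) -sqrtr_sqr.
  by apply: continuous_cvg => //; exact: sqrt_continuous.
have sDF : Num.sqrt (DF k) @[k --> \oo] --> Num.sqrt E.
  by apply: continuous_cvg => //; exact: sqrt_continuous.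
have : mu * N ^+ 2 + E - N * (mu * N) <= v * Num.sqrt E.
  have lhs : mu * NF k + DF k - N * (mu * Num.sqrt (NF k)) @[k --> \oo] -->
      mu * N ^+ 2 + E - N * (mu * N).
    apply: cvgB; first by apply: cvgD => //; exact: cvgMl_tmp.
    by apply: cvgMl_tmp; exact: cvgMl_tmp.
  have rhs : v * Num.sqrt (DF k) @[k --> \oo] --> v * Num.sqrt E by exact: cvgMl_tmp.
  by apply: (ler_cvg_to lhs rhs); apply: nearW => k; exact: deviation_truncated SN Sv.
have -> : mu * N ^+ 2 + E - N * (mu * N) = E by ring.
rewrite -{1}(sqr_sqrtr E0).
have := sqrtr_ge0 E; rewrite le_eqVlt => /predU1P[<-//|sE].
by rewrite expr2 ler_pM2r.
Qed.

Lemma best_approx_Gmu :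
  best_approx HC (wseminorm Mk e c) W g N = (Num.sqrt E)%:E /\
  (approximants HC (wseminorm Mk e c) N G /\
   deviation W g G = best_approx HC (wseminorm Mk e c) W g N).
Proof.
have GA : approximants HC (wseminorm Mk e c) N G.
  exact: (Gmu_approximant he hMk n0 c0 d0 mu0 K0 aK GN).
have devG : deviation W g G = (Num.sqrt E)%:E.
  by apply/le_anti; rewrite deviation_Gmu_le deviation_ge.
have bestE : best_approx HC (wseminorm Mk e c) W g N = (Num.sqrt E)%:E.
  apply/le_anti/andP; split.
    by rewrite -devG; apply: ereal_inf_lbound; exists G.
  by apply: le_ereal_inf_tmp => _ [S SA <-]; exact: deviation_ge.
by rewrite bestE.
Qed.

End Deviation.

(** * The value of the extremal error *)

Section ErrorValue.
Context (R : realType) (M : countType) (Mk : nat -> {fset M}) (hMk : exhausting Mk).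

Lemma nnsumZ (k : R) (s : M -> R) : (forall n, 0 <= s n) -> 0 <= k ->
  nnsum Mk predT (fun n => k * s n) = (k%:E * nnsum Mk predT s)%E.
Proof.
move=> s0 k0; have ks0 n : 0 <= k * s n by rewrite mulr_ge0.
rewrite -(cvg_lim _ (nnsum_cvg hMk ks0))//; apply: cvg_lim => //.
under eq_fun do rewrite -mulr_sumr EFinM.
by apply: cvgeZl => //; exact: nnsum_cvg.
Qed.

Context (a : M -> R[i]^o) (c d b : M -> R) (k : R).
Context (c0 : forall n, 0 <= c n) (d0 : forall n, 0 <= d n) (b0 : forall n, 0 <= b n).
Context (k0 : 0 < k) (bk : forall n, k * b n <= c n + d n).
Context (ab : (quotient_sum Mk (fun n => rnorm (a n) ^+ 2)%R b < +oo)%E).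

(** A form of the squared error term that is meaningful at [mu = 0] too: there it is
    [rnorm (a n) ^+ 2 / d n] where [c n] vanishes, and zero elsewhere. *)
Let err mu n := (rnorm (a n) * (1 - c n / (c n + mu * d n))) ^+ 2 / d n.

Lemma err_ge0 mu n : 0 <= err mu n.
Proof. by rewrite divr_ge0// sqr_ge0. Qed.

Lemma summable_eq0 n : c n = 0 -> d n = 0 -> a n = 0.
Proof.
move=> cn dn; move: ab; rewrite /quotient_sum; case: asboolP => // nex _.
apply/eqP; apply: contrapT => /negP an; apply: nex; exists n; split.
  by rewrite sqrf_eq0 rnorm_eq0.
have := bk n; rewrite cn dn addr0 pmulr_rle0// => bn.
by apply/le_anti; rewrite bn b0.
Qed.

(** With [t = (1 - r) ^+ 2] one has [t * d n <= d n], and [t * c n <= mu * d n] since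
    [(1 - r) * c n = mu * d n * r]. Adding these, [t * (k * b n) <= (1 + mu) * d n]. *)
Lemma err_le mu n : 0 <= mu ->
  err mu n <= (1 + mu) / k * (rnorm (a n) ^+ 2 / b n).
Proof.
move=> mu0.
have rhs0 : 0 <= (1 + mu) / k * (rnorm (a n) ^+ 2 / b n).
  by rewrite mulr_ge0 ?divr_ge0 ?sqr_ge0 ?(ltW k0)// addr_ge0.
have [dn|dn] := eqVneq (d n) 0; first by rewrite /err dn invr0 mulr0.
have d_gt0 : 0 < d n by rewrite lt_neqAle eq_sym dn d0.
have [bn|bn] := eqVneq (b n) 0.
  move: ab; rewrite /quotient_sum; case: asboolP => // nex _.
  have [an|an] := eqVneq (a n) 0; first by rewrite /err an rnorm0 mul0r expr0n !mul0r mulr0.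
  by exfalso; apply: nex; exists n; split => //; rewrite sqrf_eq0 rnorm_eq0.
have b_gt0 : 0 < b n by rewrite lt_neqAle eq_sym bn b0.
rewrite /err exprMn [leRHS]mulrCA -mulrA ler_wpM2l ?sqr_ge0//.
set r := c n / _.
have r0 : 0 <= r by exact: ratio_ge0.
have r1 : r <= 1 by exact: ratio_le1.
have rc : (1 - r) * c n = mu * d n * r.
  have [cd|cd] := eqVneq (c n + mu * d n) 0.
    move/eqP: (cd); rewrite paddr_eq0 ?mulr_ge0// => /andP[/eqP cn _].
    by rewrite /r cd invr0 cn !mulr0.
  by rewrite /r; field.
rewrite -[leRHS]mulrA -invfM ler_pdivlMr ?mulr_gt0// mulrAC ler_pdivrMr//.
have := bk n; have := c0 n.
have : (1 - r) ^+ 2 * c n <= mu * d n.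
  rewrite expr2 -mulrA rc mulrCA ler_piMr ?mulr_ge0 ?(ltW d_gt0)//.
  nra.
have : (1 - r) ^+ 2 <= 1 by nra.
move: ((1 - r) ^+ 2) (sqr_ge0 (1 - r)) => t t0 t1 tc cn0 bkn.
have : t * (k * b n) <= t * (c n + d n) by rewrite ler_wpM2l.
nra.
Qed.

Lemma err_summable mu : 0 <= mu -> (nnsum Mk predT (err mu) < +oo)%E.
Proof.
move=> mu0; have ab0 n : 0 <= rnorm (a n) ^+ 2 / b n by rewrite divr_ge0// sqr_ge0.
apply: le_lt_trans (le_nnsum hMk (err_ge0 mu) (fun n => err_le n mu0)) _.
rewrite nnsumZ//; last by rewrite divr_ge0 ?(ltW k0)// addr_ge0.
apply: lte_mul_pinfty => //; first by rewrite lee_fin divr_ge0 ?(ltW k0)// addr_ge0.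
move: ab; rewrite /quotient_sum; case: asboolP => // _.
by rewrite nnsum_mkcond// => n /negPn/eqP ->; rewrite invr0 mulr0.
Qed.

Lemma nnsum_errE mu : 0 <= mu ->
  nnsum Mk predT (err mu) = (fine (nnsum Mk predT (err mu)))%:E.
Proof.
move=> mu0; rewrite fineK// ge0_fin_numE ?err_summable//.
by apply: nnsum_ge0 => //; exact: err_ge0.
Qed.

(** Here [1 - r] is [mu * d n / (c n + mu * d n)], so [err mu] is [mu ^+ 2] times the summand of the
    formula. A zero denominator forces [d n = 0], which rules out the infinite branch of
    [quotient_sum]. *)
Lemma extremal_error_posE mu : 0 < mu ->
  extremal_error_pos Mk a c d mu = (Num.sqrt (fine (nnsum Mk predT (err mu))))%:E.
Proof.
move=> mu0; rewrite /extremal_error_pos /quotient_sum.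
have cd0 n : (c n + mu * d n) ^+ 2 = 0 -> d n = 0.
  move=> /eqP; rewrite sqrf_eq0 paddr_eq0 ?mulr_ge0 ?(ltW mu0)// => /andP[_].
  by rewrite mulf_eq0 gt_eqF//= => /eqP.
case: asboolP => [[n [adn /cd0 dn]]|_]; first by rewrite dn mulr0 eqxx in adn.
rewrite nnsum_mkcond => [|n /negPn/eqP ->]; last by rewrite invr0 mulr0.
set s := fun n => _.
have s0 n : 0 <= s n by rewrite divr_ge0 ?sqr_ge0// mulr_ge0 ?sqr_ge0.
have errE : err mu = fun n => mu ^+ 2 * s n.
  apply/funext => n; rewrite /err /s.
  have [dn|dn] := eqVneq (d n) 0; first by rewrite dn invr0 !mulr0 mul0r mulr0.
  have cdn : c n + mu * d n != 0.
    by apply: contra_neq dn => cdn; apply: cd0; rewrite cdn expr0n.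
  by field; rewrite dn cdn.
rewrite -[RHS]/(sqrte (fine _)%:E) -(nnsum_errE (ltW mu0)) errE nnsumZ ?sqr_ge0//.
rewrite sqrteM ?lee_fin ?sqr_ge0//= sqrtr_sqr gtr0_norm// muleA.
Qed.

Context (N : R) (Nsum : nnsum Mk predT
  (fun n => (rnorm (a n) * (c n / (c n + 0 * d n))) ^+ 2 / c n) = (N ^+ 2)%:E).

(** If [c n = 0] the two error terms coincide. Otherwise [err 0 n = 0], and the upper bound reduces
    to [mu * c n * d n <= (c n + mu * d n) ^+ 2]. *)
Lemma err0_le_errmu mu n : 0 < mu -> err 0 n <= err mu n <=
  err 0 n + mu * ((rnorm (a n) * (c n / (c n + 0 * d n))) ^+ 2 / c n).
Proof.
move=> mu0; rewrite /err mul0r addr0.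
have [cn|cn] := eqVneq (c n) 0.
  by rewrite cn !mul0r mulr0 expr0n mul0r mulr0 addr0 lexx.
rewrite divff// subrr mulr0 expr0n mul0r add0r mulr1 (err_ge0 mu)/=.
have [dn|dn] := eqVneq (d n) 0.
  by rewrite dn invr0 mulr0 mulr_ge0 ?(ltW mu0)// divr_ge0// sqr_ge0.
have c_gt0 : 0 < c n by rewrite lt_neqAle eq_sym cn c0.
have d_gt0 : 0 < d n by rewrite lt_neqAle eq_sym dn d0.
have cd_gt0 : 0 < c n + mu * d n by rewrite addr_gt0// mulr_gt0.
rewrite exprMn [leRHS]mulrCA -mulrA ler_wpM2l ?sqr_ge0//.
have -> : (1 - c n / (c n + mu * d n)) ^+ 2 / d n =
    mu ^+ 2 * d n / (c n + mu * d n) ^+ 2.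
  by field; rewrite dn gt_eqF.
rewrite ler_pdivrMr ?exprn_gt0// [leRHS]mulrAC ler_pdivlMr//.
have : 0 <= mu * (c n ^+ 2 + mu * c n * d n + mu ^+ 2 * d n ^+ 2).
  by rewrite mulr_ge0 ?(ltW mu0)// !addr_ge0// ?sqr_ge0 ?mulr_ge0 ?(ltW mu0) ?sqr_ge0.
nra.
Qed.

(** The squared error at [mu] is squeezed between its value at 0 and that value plus [mu * N ^+ 2];
    the square root is continuous. *)
Lemma extremal_error0E :
  extremal_error Mk a c d 0 = (Num.sqrt (fine (nnsum Mk predT (err 0))))%:E.
Proof.
rewrite /extremal_error eqxx; apply: cvg_lim => //.
set E := fun mu => fine (nnsum Mk predT (err mu)).
have E_cvg : E mu @[mu --> 0^'+] --> E 0.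
  apply: (@squeeze_cvgr _ _ _ _ (fun=> E 0) (fun mu => E 0 + mu * N ^+ 2)).
  - near=> mu; have mu0 : 0 < mu by near: mu; exact: nbhs_right_gt.
    rewrite -!lee_fin EFinD EFinM -Nsum -!nnsum_errE// ?(ltW mu0)//.
    apply/andP; split.
      apply: le_nnsum => // n; first exact: err_ge0.
      by case/andP: (err0_le_errmu n mu0).
    have t0 n : 0 <= (rnorm (a n) * (c n / (c n + 0 * d n))) ^+ 2 / c n.
      by rewrite divr_ge0// sqr_ge0.
    apply: nnsum_le => // [n|l]; first exact: err_ge0.
    apply: (@le_trans _ _ ((\sum_(n <- Mk l) err 0 n)%:E + mu%:E *
        (\sum_(n <- Mk l) (rnorm (a n) * (c n / (c n + 0 * d n))) ^+ 2 / c n)%:E))%E.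
      rewrite -EFinM -EFinD lee_fin mulr_sumr -big_split/=; apply: ler_sum => n _.
      by case/andP: (err0_le_errmu n mu0).
    apply: leeD; first exact: nnsum_ge (err_ge0 0).
    by apply: lee_wpmul2l; [rewrite lee_fin ltW|exact: nnsum_ge].
  - exact: cvg_cst.
  - rewrite -[X in _ --> X]addr0 -[X in _ --> _ + X](mul0r (N ^+ 2)).
    apply: cvgD; first exact: cvg_cst.
    by apply: cvgMr_tmp; apply: cvg_at_right_filter; exact: cvg_id.
have sqrtE_cvg : Num.sqrt (E mu) @[mu --> 0^'+] --> Num.sqrt (E 0).
  by apply: continuous_cvg => //; exact: sqrt_continuous.
have : (Num.sqrt (E mu))%:E @[mu --> 0^'+] --> (Num.sqrt (E 0))%:E.
  by apply: cvg_EFin => //; exact: nearW.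
apply: cvg_trans; apply: near_eq_cvg; near=> mu; rewrite extremal_error_posE//.
Unshelve. all: by end_near. Qed.

End ErrorValue.

(** * Comparison of weights *)

Section Weights.
Context (R : realType) (H H' : hilbertSpace R) (M : countType) (e : M -> H).
Context (r : nat) (T : 'I_r.+1 -> operator H H').

Lemma weight_ge0 (h : 'I_r.+1 -> R) n : (forall j, 0 < h j) -> 0 <= weight e T h n.
Proof. by move=> h0; apply: sumr_ge0 => j _; rewrite mulr_ge0 ?sqr_ge0// ltW. Qed.

(** The inverse of the sum of all [(h j)^-1] is positive and lies below every [h j]. It transfers
    the summability hypothesis, stated with unit weights, to [h'] and [h'']. *)
Lemma weight_lower (h : 'I_r.+1 -> R) : (forall j, 0 < h j) ->
  exists2 k, 0 < k & forall n, k * weight e T (fun=> 1) n <= weight e T h n.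
Proof.
move=> h0; pose S := \sum_j (h j)^-1.
have hS j : (h j)^-1 <= S.
  by rewrite /S (bigD1 j)//= lerDl sumr_ge0// => i _; rewrite invr_ge0 ltW.
have S0 : 0 < S by apply: lt_le_trans (hS ord0); rewrite invr_gt0.
exists S^-1; first by rewrite invr_gt0.
move=> n; rewrite mulr_sumr; apply: ler_sum => j _; rewrite mul1r ler_wpM2r ?sqr_ge0//.
by rewrite -[leRHS]invrK lef_pV2 ?posrE ?invr_gt0.
Qed.

End Weights.


Theorem theorem5 (R : realType) (H H' : hilbertSpace R)
  (M : countType) (Mk : nat -> {fset M}) (e : M -> H)
  (hMk : exhausting Mk) (he : orthonormal_basis e)
  (p q : nat) (h' : 'I_p.+1 -> R) (h'' : 'I_q.+1 -> R)
  (h'_gt0 : forall j, 0 < h' j) (h''_gt0 : forall j, 0 < h'' j)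
  (C : 'I_p.+1 -> operator H H') (D : 'I_q.+1 -> operator H H')
  (C_closed : forall j, closed_operator (C j))
  (D_closed : forall j, closed_operator (D j))
  (C_adapted : adapted e C) (D_adapted : adapted e D)
  (X : normedModType R[i]) (A : operator H X) (f : {linear X -> R[i]^o})
  (f_bounded : exists K : R, forall y : X, rnorm (f y) <= K * rnorm y)
  (A_basis : forall n, dom A (e n))
  (fA_neq0 : exists n, f (A (e n)) != 0)
  (gf_closable : closable (comp_op f A)) :
  let fA : H -> R[i]^o := fun x => f (A x) in
  let a : M -> R[i]^o := fun n => fA (e n) in
  let c := weight e C h' in
  let d := weight e D h'' in
  let b1 := fun n => weight e C (fun=> 1) n + weight e D (fun=> 1) n in
  let HC := wspace Mk e C in
  let HD := wspace Mk e D in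
  let normC := wseminorm Mk e c in
  let normD := wseminorm Mk e d in
  let W := [set x | [/\ dom A x, HC x, HD x & (normD x <= 1)%E]] in
  let DfA := dom A `&` HC in
  (quotient_sum Mk (fun n => rnorm (a n) ^+ 2)%R b1 < +oo)%E ->
  forall N mu : R,
  (~ seminorm_bounded DfA normC fA /\ (Nstar Mk e a c d HC < N%:E)%E \/
   seminorm_bounded DfA normC fA /\
     (Nstar Mk e a c d HC < N%:E /\ N%:E <= fun_norm DfA normC fA)%E) ->
  0 <= mu ->
  N%:E = fun_norm HC normC (Gmu Mk e a c d mu) ->
  best_approx HC normC W fA N = extremal_error Mk a c d mu /\
  (approximants HC normC N (Gmu Mk e a c d mu) /\
   deviation W fA (Gmu Mk e a c d mu) = best_approx HC normC W fA N).
Proof.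
move=> fA a c d b1 HC HD normC normD W DfA ab N mu _ mu0 NG.
have c0 n : 0 <= c n by exact: weight_ge0.
have d0 n : 0 <= d n by exact: weight_ge0.
have b0 n : 0 <= b1 n by rewrite addr_ge0//; apply: weight_ge0 => j; exact: ltr01.
have [kC kC0 kCP] := weight_lower e C h'_gt0.
have [kD kD0 kDP] := weight_lower e D h''_gt0.
have k0 : 0 < Num.min kC kD by rewrite lt_min kC0 kD0.
have bk n : Num.min kC kD * b1 n <= c n + d n.
  rewrite mulrDr lerD//; [apply: le_trans (kCP n)|apply: le_trans (kDP n)];
  rewrite ler_wpM2r ?ge_min ?lexx ?orbT//; apply: weight_ge0 => j; exact: ltr01.
(* The index [n0] supplies the line into which [coef_series_cvg] carries its partial sums. *)
have [n0 _] := fA_neq0.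
have [K K0 gK] := closable_functional_bounded gf_closable.
pose E := fine (nnsum Mk predT
  (fun n => (rnorm (a n) * (1 - c n / (c n + mu * d n))) ^+ 2 / d n)).
have EP : nnsum Mk predT
    (fun n => (rnorm (a n) * (1 - c n / (c n + mu * d n))) ^+ 2 / d n) = E%:E.
  exact: (nnsum_errE hMk c0 d0 b0 k0 bk ab mu0).
(* Where [a n] is nonzero the weights do not vanish together, so the denominators in [tau] are
   nonzero wherever [tauP] is required. *)
have an0 n : a n != 0 -> c n = 0 -> d n != 0.
  by move=> an cn; apply: contra_neq an => dn; exact: (summable_eq0 b0 k0 bk ab cn dn).
have -> : extremal_error Mk a c d mu = (Num.sqrt E)%:E.
  have [mu_eq0|mu_neq0] := eqVneq mu 0; last first.
    rewrite /extremal_error (negPf mu_neq0).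
    have mu_gt0 : 0 < mu by rewrite lt_neqAle eq_sym mu_neq0.
    exact: (extremal_error_posE hMk c0 d0 b0 k0 bk ab mu_gt0).
  rewrite /E mu_eq0; apply: (@extremal_error0E _ _ _ hMk a c d b1 _ c0 d0 b0 k0 bk ab N).
  have aK k := bounded_sum_sqr he (A_basis : forall n, dom (comp_op f A) (e n)) K0 gK
    (fset_uniq (Mk k)).
  (* At [mu = 0] the norm formula for [Gmu] provides the finite sum [N ^+ 2] that controls the
     squeeze. *)
  have := @Gmu_norm_sum _ _ _ _ _ he _ hMk n0 _ C a c d mu K c0 d0 mu0 K0 aK N (esym NG).
  by rewrite mu_eq0.
(* At [mu = 0] the test vectors live where [c] vanishes, and are seminorm-null. *)
pose tau n := if mu == 0 then (if c n == 0 then (d n)^-1 else 0) else mu / (c n + mu * d n).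
have tau0 n : 0 <= tau n.
  rewrite /tau; case: ifP => _; last by rewrite divr_ge0// addr_ge0// mulr_ge0.
  by case: ifP => _ //; rewrite invr_ge0.
apply: (@best_approx_Gmu _ _ _ _ _ he _ hMk n0 _ _ C D (comp_op f A) A_basis K K0 gK
  c d mu N c0 d0 mu0 (esym NG) tau tau0 _ E EP) => n an.
rewrite /tau; have [mu_eq0|mu_neq0] := eqVneq mu 0.
  rewrite mu_eq0 mul0r addr0 mul0r; have [cn|cn] := eqVneq (c n) 0.
    by rewrite cn mul0r subr0 mulr0 mulVf// an0.
  by rewrite divff// subrr !mul0r.
have cdn : c n + mu * d n != 0.
  rewrite paddr_eq0 ?mulr_ge0// mulf_eq0 (negPf mu_neq0)/=; apply/negP => /andP[/eqP cn].
  by rewrite (negPf (an0 n an cn)).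
by split; field.
Qed.
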